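(* Let $A$ be an $m\times n$ real matrix with full column rank, and let $b=Ax_*$ with $x_*\in\mathbb{R}^n$. Suppose each $S_k$, $k=0,1,2,\dots$, is an independent copy of a random sketching matrix $S\in\mathbb{R}^{m\times p}$. Put $H=P_{A^{T}S}$ and $G=\mathbb{E}[H]$. Let $\mu=\lambda_{\min}(\mathbb{E}[P_{A^{T}S}])$, suppose $\mu>0$, and let $$\nu=\lambda_{\max}\left(\mathbb{E}\left[(G^{-1/2}HG^{-1/2})^2\right]\right),\qquad\tau=\sqrt{\mu/\nu}.$$ Let $x_0\in\mathbb{R}^n$, $y_0=z_0=x_0$, and for $k\ge0$, with $r_{k}=Ax_{k}-b$, define $$x_{k+1}=\tfrac{1}{1+\tau}y_k+\tfrac{\tau}{1+\tau}z_k,$$ $$y_{k+1}=x_{k+1}-(S_k^{T}A)^{\dagger}S_k^{T}r_{k+1},$$ $$z_{k+1}=z_k+\tau(x_{k+1}-z_k)-\tfrac{\tau}{\mu}(S_k^{T}A)^{\dagger}S_k^{T}r_{k+1}.$$ Then for all $k\geq0$, $$\mathbb{E}[\|y_k-x_*\|_2]\leq\sqrt2\,(1-\tau)^{k/2}\|x_0-x_*\|_2.$$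
   Context: For a matrix $M$, $M^{\dagger}$ is the Moore-Penrose pseudo-inverse and $P_M$ the orthogonal projector onto the range of $M$; for positive semi-definite $M$, $M^{1/2}$ is its positive semi-definite square root; $\lambda_{\min},\lambda_{\max}$ denote smallest and largest eigenvalues; $\|\cdot\|_2$ is the Euclidean norm. *)

(* Defs.v *)
From mathcomp Require Import all_boot all_order all_algebra.
From mathcomp Require Import finmap.
From mathcomp Require Import all_classical all_reals all_analysis.

Set Implicit Arguments.
Unset Strict Implicit.
Unset Printing Implicit Defensive.

Import Order.TTheory GRing.Theory Num.Theory.

Local Open Scope classical_set_scope.
Local Open Scope ring_scope.

Section LinearAlgebra.
Variable R : realType.

Definition enorm2 n (v : 'cV[R]_n) : R := Num.sqrt (\sum_i v i 0 ^+ 2).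

(* The four Penrose equations, which determine X uniquely; over the reals the
   adjoint is the transpose. *)
Definition is_mp_pinv m n (M : 'M[R]_(m, n)) (X : 'M[R]_(n, m)) : Prop :=
  [/\ M *m X *m M = M, X *m M *m X = X,
      (M *m X)^T = M *m X & (X *m M)^T = X *m M].

Definition mp_pinv m n (M : 'M[R]_(m, n)) : 'M[R]_(n, m) :=
  xget 0 [set X | is_mp_pinv M X].

(* The range is the column space, whereas the relation :=: of mxalgebra
   compares row spaces, hence the transposes. *)
Definition is_orth_proj m n (M : 'M[R]_(m, n)) (Q : 'M[R]_m) : Prop :=
  [/\ Q^T = Q, Q *m Q = Q & (Q^T :=: M^T)%MS].

Definition orth_proj m n (M : 'M[R]_(m, n)) : 'M[R]_m :=
  xget 0 [set Q | is_orth_proj M Q].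

Definition psdmx n (M : 'M[R]_n) : Prop :=
  M^T = M /\ forall v : 'cV[R]_n, 0 <= (v^T *m M *m v) 0 0.

(* Only meaningful for M positive semi-definite. *)
Definition psd_sqrt n (M : 'M[R]_n) : 'M[R]_n :=
  xget 0 [set X | psdmx X /\ X *m X = M].

(* A matrix has finitely many eigenvalues, so for a symmetric matrix of positive
   size the infimum and the supremum are attained. For n = 0 both are 0. *)
Definition lambda_min n (M : 'M[R]_n) : R := inf [set a | eigenvalue M a].
Definition lambda_max n (M : 'M[R]_n) : R := sup [set a | eigenvalue M a].

End LinearAlgebra.

Section RandomMatrices.
Context {R : realType} {d : measure_display} {T : measurableType d}.
Variable P : probability T R.

Definition random_mx m n (X : T -> 'M[R]_(m, n)) : Prop :=
  forall i j, measurable_fun [set: T] (fun w => X w i j).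

Definition expect_mx m n (X : T -> 'M[R]_(m, n)) : 'M[R]_(m, n) :=
  \matrix_(i, j) fine 'E_P[fun w => X w i j].

(* The Borel sigma-algebra, presented as the product sigma-algebra of R^(m x n). *)
Definition mx_borel m n : set (set 'M[R]_(m, n)) :=
  <<s [set C | exists i j, exists2 B : set R,
         measurable B & C = [set M : 'M[R]_(m, n) | B (M i j)]] >>.

Definition same_law m n (X Y : T -> 'M[R]_(m, n)) : Prop :=
  forall B, mx_borel B -> P (X @^-1` B) = P (Y @^-1` B).

Definition mutually_independent m n (X : nat -> T -> 'M[R]_(m, n)) : Prop :=
  forall (J : {fset nat}) (B : nat -> set 'M[R]_(m, n)),
    (forall j, mx_borel (B j)) ->
    P (\bigcap_(j in [set` J]) (X j @^-1` B j))
      = (\prod_(j <- J) P (X j @^-1` B j))%E.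

End RandomMatrices.

(* Main.v *)
Require Import Defs.
From HB Require Import structures.
From mathcomp Require Import all_boot all_order all_algebra finmap.
From mathcomp Require Import all_classical all_reals all_analysis.
From mathcomp Require Import measurable_realfun ring lra.

(** The update of y subtracts from the error e = x - xs its orthogonal
    projection H e, because pinv(S^T A) S^T A is the orthogonal projector onto
    the range of A^T S; the update of z moves along the same vector. With G = E[H],
    the potential V(y, z) = |z|^2_{G^-1} + |y|^2 / mu of the errors then
    contracts in mean: E[V(y', z') | y, z] <= (1 - tau) V(y, z), see
    [mean_potential_le]. This rests on mu <= G, hence G^-1 <= 1 / mu, on
    E[H G^-1 H] <= nu G, and on tau^2 nu = mu. Moreover mu <= 1 <= nu, so that
    tau <= 1.

    Since S_k is independent of the events determined by S_0, ..., S_(k-1), and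
    y_k and z_k depend only on S_0, ..., S_(k-1), the one-step estimate for frozen y and z integrates
    to E[V(y_(k+1), z_(k+1))] <= (1 - tau) E[V(y_k, z_k)], by
    [history_independent] and [integral_independent_le]. As |y|^2 <= mu V(y, z)
    and mu V(e, e) <= 2 |e|^2 for the initial error e, the second moment of the
    error of y_k is at most 2 (1 - tau)^k |e|^2, and the first moment is at most
    the square root of that bound.

    Spectral facts are obtained over the reals: the least Rayleigh quotient of a
    symmetric matrix is an eigenvalue ([rayleigh_eigenvalue]), which bounds
    quadratic forms by the extreme eigenvalues and, by deflation, produces
    square roots. Projectors are built by Gram-Schmidt orthogonalisation with the
    convention 0^-1 = 0 ([gram_schmidtP]); this gives their existence and their
    measurability in the sketch at once, and pseudo-inverses are assembled from
    them. *)

Set Implicit Arguments.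
Unset Strict Implicit.
Unset Printing Implicit Defensive.

Import Order.TTheory GRing.Theory Num.Theory.
Import numFieldNormedType.Exports.

Local Open Scope classical_set_scope.
Local Open Scope ring_scope.

(** * Quadratic forms and extreme eigenvalues *)

Section QuadraticForms.
Variable R : realType.

Definition bform n (M : 'M[R]_n) (u v : 'cV[R]_n) : R := (u^T *m M *m v) 0 0.
Definition qform n (M : 'M[R]_n) (v : 'cV[R]_n) : R := bform M v v.
Definition sqnorm n (v : 'cV[R]_n) : R := qform 1%:M v.

Lemma bformDl n (M : 'M[R]_n) u1 u2 v :
  bform M (u1 + u2) v = bform M u1 v + bform M u2 v.
Proof. by rewrite /bform linearD !mulmxDl mxE. Qed.

Lemma bformDr n (M : 'M[R]_n) u v1 v2 :
  bform M u (v1 + v2) = bform M u v1 + bform M u v2.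
Proof. by rewrite /bform mulmxDr mxE. Qed.

Lemma bformZl n (M : 'M[R]_n) a u v : bform M (a *: u) v = a * bform M u v.
Proof. by rewrite /bform linearZ -!scalemxAl mxE. Qed.

Lemma bformZr n (M : 'M[R]_n) a u v : bform M u (a *: v) = a * bform M u v.
Proof. by rewrite /bform -!scalemxAr mxE. Qed.

Lemma bformNl n (M : 'M[R]_n) u v : bform M (- u) v = - bform M u v.
Proof. by rewrite -scaleN1r bformZl mulN1r. Qed.

Lemma bformNr n (M : 'M[R]_n) u v : bform M u (- v) = - bform M u v.
Proof. by rewrite -scaleN1r bformZr mulN1r. Qed.

Lemma bformDm n (M N : 'M[R]_n) u v :
  bform (M + N) u v = bform M u v + bform N u v.
Proof. by rewrite /bform mulmxDr mulmxDl mxE. Qed.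

Lemma bformZm n (M : 'M[R]_n) a u v : bform (a *: M) u v = a * bform M u v.
Proof. by rewrite /bform -scalemxAr -scalemxAl mxE. Qed.

Lemma bformNm n (M : 'M[R]_n) u v : bform (- M) u v = - bform M u v.
Proof. by rewrite -scaleN1r bformZm mulN1r. Qed.

Definition bformD := (bformDl, bformDr, bformZl, bformZr, bformNl, bformNr).

Lemma trmx11 (M : 'M[R]_1) : M^T 0 0 = M 0 0.
Proof. by rewrite mxE. Qed.

Lemma bformC n (M : 'M[R]_n) u v : M^T = M -> bform M u v = bform M v u.
Proof. by move=> sM; rewrite /bform -trmx11 !trmx_mul trmxK sM mulmxA. Qed.

Lemma bform_mul n (M N : 'M[R]_n) u v : bform (M *m N) u v = bform M u (N *m v).
Proof. by rewrite /bform !mulmxA. Qed.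

Lemma bform_mull n (M N : 'M[R]_n) u v :
  bform (M *m N) u v = bform N (M^T *m u) v.
Proof. by rewrite /bform trmx_mul trmxK !mulmxA. Qed.

Lemma bformE n (M : 'M[R]_n) u v :
  bform M u v = \sum_i \sum_j u i 0 * M i j * v j 0.
Proof.
rewrite /bform !mxE exchange_big; apply: eq_bigr => j _.
by rewrite mxE mulr_suml; apply: eq_bigr => i _; rewrite mxE.
Qed.

Lemma sqnormE n (v : 'cV[R]_n) : sqnorm v = \sum_i v i 0 ^+ 2.
Proof.
rewrite /sqnorm /qform /bform mulmx1 !mxE; apply: eq_bigr => i _.
by rewrite mxE expr2.
Qed.

Lemma bform1 n (v : 'cV[R]_n) : bform 1%:M v v = sqnorm v.
Proof. by []. Qed.

Lemma qform0 n (M : 'M[R]_n) : qform M 0 = 0.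
Proof. by rewrite /qform /bform mulmx0 mxE. Qed.

Lemma sqnorm_ge0 n (v : 'cV[R]_n) : 0 <= sqnorm v.
Proof. by rewrite sqnormE sumr_ge0 // => i _; exact: sqr_ge0. Qed.

Lemma sqnorm_eq0 n (v : 'cV[R]_n) : (sqnorm v == 0) = (v == 0).
Proof.
apply/idP/eqP => [|->]; last by rewrite /sqnorm /qform /bform mulmx0 mxE.
rewrite sqnormE psumr_eq0 => [/allP v0|i _]; last exact: sqr_ge0.
apply/colP => i; rewrite mxE; apply/eqP.
by rewrite -sqrf_eq0; apply: v0; rewrite mem_index_enum.
Qed.

Lemma sqnorm_gt0 n (v : 'cV[R]_n) : (0 < sqnorm v) = (v != 0).
Proof. by rewrite lt0r sqnorm_ge0 sqnorm_eq0 andbT. Qed.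

Lemma sqnorm_delta n (i : 'I_n) : sqnorm (delta_mx i 0) = 1.
Proof.
rewrite sqnormE (bigD1 i) //= big1 => [|j /negPf ji].
  by rewrite mxE !eqxx addr0 expr1n.
by rewrite mxE ji expr0n.
Qed.

(** The form is nonnegative at s u + t v for all s and t; when v^T M v is
    positive, s and t are chosen proportional to the minimiser. *)
Lemma psd_Cauchy_Schwarz n (M : 'M[R]_n) u v :
  psdmx M -> bform M u v ^+ 2 <= qform M u * qform M v.
Proof.
move=> [sM pM].
have pos s t : 0 <= s ^+ 2 * qform M u + s * t * bform M u v *+ 2
                    + t ^+ 2 * qform M v.
  have := pM (s *: u + t *: v); rewrite -/(bform _ _ _) !bformD.
  by rewrite (bformC v u sM) => /le_trans; apply; rewrite /qform; lra.
have u0 : 0 <= qform M u by exact: pM.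
have v0 : 0 <= qform M v by exact: pM.
have [v_eq0|v_neq0] := eqVneq (qform M v) 0.
  (* the polynomial is affine in t, and this t makes it negative unless the
     mixed term vanishes *)
  have := pos (bform M u v) (- (qform M u + 1)); rewrite v_eq0 !mulr0 addr0.
  have := sqr_ge0 (bform M u v); nra.
have {v_neq0}v_gt0 : 0 < qform M v by rewrite lt0r v_neq0.
rewrite -subr_ge0 -(pmulr_rge0 _ v_gt0).
by apply: (le_trans (pos (qform M v) (- bform M u v))); lra.
Qed.

Lemma sqr_entry_le n (v : 'cV[R]_n) i : v i 0 ^+ 2 <= sqnorm v.
Proof.
rewrite sqnormE (bigD1 i) //= lerDl sumr_ge0 // => j _; exact: sqr_ge0.
Qed.

Lemma qform_bounded n (M : 'M[R]_n) :
  exists2 C, 0 <= C & forall v, `|qform M v| <= C * sqnorm v.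
Proof.
exists (\sum_i \sum_j `|M i j|).
  by apply: sumr_ge0 => i _; apply: sumr_ge0 => j _.
move=> v; rewrite /qform bformE mulr_suml.
apply: (le_trans (ler_norm_sum _ _ _)); apply: ler_sum => i _.
rewrite mulr_suml; apply: (le_trans (ler_norm_sum _ _ _)); apply: ler_sum => j _.
rewrite mulrAC normrM mulrC ler_wpM2l //.
have := sqr_entry_le v i; have := sqr_entry_le v j.
have := sqr_ge0 (v i 0 - v j 0); have := sqr_ge0 (v i 0 + v j 0).
by rewrite ler_norml => *; nra.
Qed.

Lemma sub_scalar_qform n (M : 'M[R]_n) a v :
  qform (M - a%:M) v = qform M v - a * sqnorm v.
Proof. by rewrite /qform bformDm bformNm -scalemx1 bformZm. Qed.

(** The Cauchy-Schwarz inequality for M applied to v and M^-1 v bounds |v|^4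
    by the product of v^T M v and v^T M^-1 v. *)
Lemma psd_unit_coercive n (M : 'M[R]_n) : psdmx M -> M \in unitmx ->
  exists2 e, 0 < e & forall v, e * sqnorm v <= qform M v.
Proof.
move=> pM uM; have [C C0 hC] := qform_bounded (invmx M).
exists (C + 1)^-1 => [|v]; first by rewrite invr_gt0 ltr_wpDl.
have := psd_Cauchy_Schwarz v (invmx M *m v) pM.
rewrite -bform_mul mulmxV // -/(qform _ v) -/(sqnorm v).
have -> : qform M (invmx M *m v) = qform (invmx M) v.
  have sMV : (invmx M)^T = invmx M by rewrite trmx_inv pM.1.
  by rewrite /qform -bform_mul mulmxV // -{1}sMV -bform_mull mulmx1.
move=> hv; have M0 : 0 <= qform M v by exact: pM.2.
have [->|v0] := eqVneq v 0; first by rewrite /sqnorm !qform0 mulr0.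
have v_gt0 : 0 < sqnorm v by rewrite sqnorm_gt0.
rewrite mulrC ler_pdivrMr ?ltr_wpDl // -(ler_pM2l v_gt0) -expr2.
apply: (le_trans hv); have := hC v; rewrite ler_norml => /andP[_ hCv]; nra.
Qed.

(** The least value a of the Rayleigh quotient is an eigenvalue, because
    M - a is positive semi-definite but not coercive. *)
Lemma rayleigh_eigenvalue n (M : 'M[R]_n.+1) : M^T = M ->
  exists2 a, eigenvalue M a & forall v, a * sqnorm v <= qform M v.
Proof.
move=> sM; pose E := [set a | forall v, a * sqnorm v <= qform M v].
have [C C0 hC] := qform_bounded M.
have E0 : E !=set0.
  by exists (- C) => v; have := hC v; rewrite ler_norml mulNr => /andP[].
have ubE v : v != 0 -> ubound E (qform M v / sqnorm v).
  by move=> v0 a Ea; rewrite ler_pdivlMr ?sqnorm_gt0.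
have d0 : delta_mx 0 0 != 0 :> 'cV[R]_n.+1.
  by rewrite -sqnorm_gt0 sqnorm_delta.
have hE : has_ubound E by eexists; exact: ubE d0.
have Ea : E (sup E).
  move=> v; have [->|v0] := eqVneq v 0; first by rewrite /sqnorm !qform0 mulr0.
  by rewrite -ler_pdivlMr ?sqnorm_gt0 //; apply: ge_sup => //; exact: ubE.
exists (sup E) => //; apply: contraT => neig.
have uM : M - (sup E)%:M \in unitmx.
  move: neig; rewrite /eigenvalue /eigenspace negbK kermx_eq0.
  by rewrite row_free_unit.
have pM : psdmx (M - (sup E)%:M).
  split; first by rewrite linearB /= sM tr_scalar_mx.
  move=> v; rewrite -/(bform _ _ _) -/(qform _ v) sub_scalar_qform subr_ge0.
  exact: Ea.
have [e e0 he] := psd_unit_coercive pM uM.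
suff : sup E + e <= sup E by rewrite gerDl leNgt e0.
apply: ub_le_sup => // v; have := he v.
by rewrite sub_scalar_qform mulrDl lerBrDl.
Qed.

Lemma sym_eigenvector n (M : 'M[R]_n) a : M^T = M -> eigenvalue M a ->
  exists2 v : 'cV[R]_n, sqnorm v = 1 & M *m v = a *: v.
Proof.
move=> sM /eigenvalueP[u uM u0].
have nu : 0 < sqnorm u^T by rewrite sqnorm_gt0 -trmx0 (inj_eq trmx_inj).
exists ((Num.sqrt (sqnorm u^T))^-1 *: u^T).
  rewrite /sqnorm /qform bformZl bformZr mulrA -expr2 exprVn sqr_sqrtr ?ltW //.
  by rewrite mulVf // gt_eqF.
by rewrite -scalemxAr -{1}sM -trmx_mul uM linearZ /= !scalerA mulrC.
Qed.

(** The infimum defining lambda_min is at most the attained minimum of the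
    Rayleigh quotient. *)
Lemma lambda_minP n (M : 'M[R]_n.+1) v :
  M^T = M -> lambda_min M * sqnorm v <= qform M v.
Proof.
move=> sM; have [a ea ha] := rayleigh_eigenvalue sM.
suff la : lambda_min M <= a.
  by apply: (le_trans _ (ha v)); rewrite ler_wpM2r ?sqnorm_ge0.
apply: ge_inf => //; exists a => b /(sym_eigenvector sM)[w w1 Mw].
have := ha w; rewrite /qform -(mul1mx M) bform_mul Mw bformZr.
by rewrite -/(qform _ _) -/(sqnorm _) w1 !mulr1.
Qed.

(** The largest eigenvalue of M is minus the smallest one of -M. *)
Lemma lambda_maxP n (M : 'M[R]_n.+1) v :
  M^T = M -> qform M v <= lambda_max M * sqnorm v.
Proof.
move=> sM; have sNM : (- M)^T = - M by rewrite linearN /= sM.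
have [a ea ha] := rayleigh_eigenvalue sNM.
have eNa : eigenvalue M (- a).
  have /eigenvalueP[u uM u0] := ea; apply/eigenvalueP; exists u => //.
  by rewrite scaleNr -uM mulmxN opprK.
suff la : - a <= lambda_max M.
  have := ha v; rewrite /qform bformNm lerNr -mulNr => /le_trans; apply.
  by rewrite ler_wpM2r ?sqnorm_ge0.
apply: ub_le_sup => //; exists (- a) => b /(sym_eigenvector sM)[w w1 Mw].
have := ha w; rewrite /qform bformNm -(mul1mx M) bform_mul Mw bformZr.
by rewrite -/(qform _ _) -/(sqnorm _) w1 !mulr1 lerNr.
Qed.

Lemma lambda_min0 (M : 'M[R]_0) : lambda_min M = 0.
Proof.
rewrite /lambda_min (_ : [set _ | _] = set0) ?inf0 //.
by apply/seteqP; split=> // a /eigenvalueP[v _]; rewrite thinmx0 eqxx.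
Qed.

(** * Square roots of positive semi-definite matrices *)

(** A Householder reflection exchanges u and the first basis vector. When the
    two coincide, the scaling factor is 0^-1 = 0 and the formula gives the
    identity, as it should. *)
Lemma reflection_to n (u : 'cV[R]_n.+1) : sqnorm u = 1 ->
  exists Q : 'M[R]_n.+1, [/\ Q^T = Q, Q *m Q = 1%:M & Q *m delta_mx 0 0 = u].
Proof.
move=> u1; pose e : 'cV[R]_n.+1 := delta_mx 0 0; pose w := u - e.
pose W := w *m w^T; pose c := (sqnorm w)^-1.
have WW : W *m W = sqnorm w *: W.
  rewrite /W mulmxA -[_ *m w^T *m w]mulmxA (mx11_scalar (w^T *m w)).
  by rewrite mul_mx_scalar -scalemxAl /sqnorm /qform /bform mulmx1.
have WT : W^T = W by rewrite /W trmx_mul trmxK.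
exists (1%:M - (2 * c) *: W); split.
- by rewrite linearB linearZ /= WT trmx1.
- rewrite mulmxBl !mulmxBr !mul1mx mulmx1 -scalemxAl -scalemxAr WW !scalerA.
  have -> : 2 * c * (2 * c) * sqnorm w = 2 * c + 2 * c.
    have [w0|w0] := eqVneq (sqnorm w) 0; first by rewrite /c w0 invr0; ring.
    by rewrite /c; field.
  by rewrite scalerDl opprB addrK subrK.
- have [w0|w0] := eqVneq w 0.
    rewrite /W w0 mul0mx scaler0 subr0 mul1mx.
    by move/eqP: w0; rewrite subr_eq0 => /eqP ->.
  have sw : sqnorm w != 0 by rewrite sqnorm_eq0.
  have e1 : sqnorm e = 1 by rewrite sqnorm_delta.
  rewrite -/e mulmxBl mul1mx -scalemxAl /W -mulmxA (mx11_scalar (w^T *m _)).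
  rewrite mul_mx_scalar scalerA.
  have -> : (w^T *m e) 0 0 = - (sqnorm w / 2).
    have -> : (w^T *m e) 0 0 = bform 1%:M w e by rewrite /bform mulmx1.
    have uu : bform 1%:M u u = 1 by [].
    have ee : bform 1%:M e e = 1 by [].
    by rewrite /sqnorm /qform /w !bformD uu ee (bformC e u) ?trmx1 //; lra.
  have -> : 2 * c * - (sqnorm w / 2) = -1 by rewrite /c; field.
  by rewrite scaleN1r opprK addrC subrK.
Qed.

Lemma psd_conj n (M X : 'M[R]_n) : psdmx M -> psdmx (X^T *m M *m X).
Proof.
move=> [sM pM]; split; first by rewrite !trmx_mul trmxK sM mulmxA.
by move=> v; have := pM (X *m v); rewrite trmx_mul !mulmxA.
Qed.

(** Induction on the dimension: a reflection moves a unit eigenvector to the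
    first basis vector, and by symmetry the matrix then splits into the
    eigenvalue and a smaller positive semi-definite block. *)
Lemma psd_sqrt_exists n (M : 'M[R]_n) :
  psdmx M -> exists2 X, psdmx X & X *m X = M.
Proof.
elim: n M => [|n IH] M pM.
  by exists M => //; rewrite [M]flatmx0 mul0mx.
have [sM _] := pM; have [a ea ha] := rayleigh_eigenvalue sM.
have [u u1 Mu] := sym_eigenvector sM ea.
have a0 : 0 <= a.
  have := pM.2 u; rewrite -mulmxA Mu -scalemxAr mxE.
  by have := u1; rewrite /sqnorm /qform /bform mulmx1 => ->; rewrite mulr1.
have [Q [sQ QQ Qe]] := reflection_to u1.
have [M' [pM' M'e defM]] : exists M' : 'M[R]_(1 + n),
    [/\ psdmx M', M' *m delta_mx 0 0 = a *: (delta_mx 0 0 : 'cV[R]_(1 + n))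
       & Q *m M' *m Q = M].
  exists (Q *m M *m Q); split; first by rewrite -{1}sQ; exact: psd_conj.
    by rewrite -!mulmxA Qe Mu -scalemxAr -Qe mulmxA QQ mul1mx.
  by rewrite !mulmxA QQ mul1mx -mulmxA QQ mulmx1.
have l00 : (lshift n 0 : 'I_(1 + n)) = 0 by exact/val_inj.
have M'i0 i : M' i 0 = a * (i == 0)%:R.
  have /colP/(_ i) := M'e; rewrite !mxE (bigD1 0) //= big1.
    by rewrite !mxE !eqxx addr0 mulr1 andbT => ->.
  by move=> j /negPf j0; rewrite !mxE j0 mulr0.
pose N := drsubmx M'.
have bM' : M' = block_mx a%:M 0 0 N.
  rewrite -[LHS]submxK; congr block_mx => //.
  - by apply/matrixP => i j; rewrite !ord1 !mxE l00 M'i0 mulr1.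
  - apply/matrixP => i j; rewrite !ord1 !mxE l00 -pM'.1 mxE M'i0.
    by rewrite (_ : rshift 1 j == 0 = false) ?mulr0.
  - apply/matrixP => i j; rewrite !ord1 !mxE l00 M'i0.
    by rewrite (_ : rshift 1 i == 0 = false) ?mulr0.
have pN : psdmx N.
  split.
    by rewrite /N trmx_drsub pM'.1.
  move=> v; have := pM'.2 (col_mx 0 v).
  rewrite bM' tr_col_mx mul_row_block mul_row_col trmx0 !mul0mx !mulmx0 !add0r.
  by [].
have [Y pY YY] := IH _ pN.
pose Z : 'M[R]_(1 + n) := block_mx (Num.sqrt a)%:M 0 0 Y.
have pZ : psdmx Z.
  split; first by rewrite tr_block_mx tr_scalar_mx !trmx0 pY.1.
  move=> v; rewrite -[v]vsubmxK tr_col_mx mul_row_block mul_row_col.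
  rewrite !mulmx0 addr0 add0r mxE addr_ge0 //; last exact: pY.2.
  rewrite mul_mx_scalar -scalemxAl mxE mulr_ge0 ?sqrtr_ge0 //.
  have := sqnorm_ge0 (usubmx v).
  by rewrite /sqnorm /qform /bform mulmx1.
have ZZ : Z *m Z = M'.
  rewrite bM' /Z mulmx_block !mulmx0 !mul0mx !addr0 !add0r YY.
  by rewrite -scalar_mxM -expr2 sqr_sqrtr.
exists (Q *m Z *m Q); first by rewrite -{1}sQ; exact: psd_conj.
rewrite !mulmxA -[Q *m Z *m Q *m Q]mulmxA QQ mulmx1 -[Q *m Z *m Z]mulmxA ZZ.
by [].
Qed.

Lemma psd_sqrtP n (M : 'M[R]_n) : psdmx M ->
  psdmx (psd_sqrt M) /\ psd_sqrt M *m psd_sqrt M = M.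
Proof.
move=> /psd_sqrt_exists[X pX XX].
by rewrite /psd_sqrt; case: xgetP => [Y _ [? ?] //|/(_ X)[]].
Qed.

End QuadraticForms.

(** * Orthogonal projectors and pseudo-inverses *)

Section Projectors.
Variable R : realType.

(** Equal row spaces make each projector absorb the other, Q1 Q2 = Q1 and
    Q2 Q1 = Q2; transposing the second identity gives Q1 Q2 = Q2. *)
Lemma orth_proj_unique m n (M : 'M[R]_(m, n)) Q1 Q2 :
  is_orth_proj M Q1 -> is_orth_proj M Q2 -> Q1 = Q2.
Proof.
move=> [s1 i1 r1] [s2 i2 r2].
have absorb A B : A^T = A -> B^T = B -> B *m B = B -> (A^T <= B^T)%MS ->
    A *m B = A.
  by move=> -> -> iB /submxP[D ->]; rewrite -mulmxA iB.
have Q12 : Q1 *m Q2 = Q1 by apply: absorb => //; rewrite r1 r2.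
have Q21 : Q2 *m Q1 = Q2 by apply: absorb => //; rewrite r1 r2.
by rewrite -Q12 -{1}s1 -{1}s2 -trmx_mul Q21.
Qed.

Lemma orth_projE m n (M : 'M[R]_(m, n)) Q : is_orth_proj M Q -> orth_proj M = Q.
Proof.
move=> QP; rewrite /orth_proj; case: xgetP => [X _ XP|/(_ Q)/(_ QP)] //.
exact: orth_proj_unique XP QP.
Qed.

Lemma is_orth_projP m n (M : 'M[R]_(m, n)) Q :
  Q^T = Q -> Q *m Q = Q -> Q *m M = M -> (exists Y, Q = M *m Y) ->
  is_orth_proj M Q.
Proof.
move=> sQ iQ QM [Y QY]; split=> //; apply/eqmxP/andP; split.
  by rewrite QY trmx_mul submxMl.
by rewrite -{1}QM trmx_mul submxMl.
Qed.

Lemma is_orth_proj_id m n (M : 'M[R]_(m, n)) Q : is_orth_proj M Q -> Q *m M = M.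
Proof.
move=> [sQ iQ rQ]; apply: trmx_inj; rewrite trmx_mul.
have /submxP[D ->] : (M^T <= Q^T)%MS by rewrite rQ.
by rewrite -mulmxA sQ iQ.
Qed.

Lemma is_orth_proj_range m n (M : 'M[R]_(m, n)) Q :
  is_orth_proj M Q -> exists Y, Q = M *m Y.
Proof.
move=> [sQ iQ rQ]; have /submxP[D QD] : (Q^T <= M^T)%MS by rewrite rQ.
by exists D^T; apply: trmx_inj; rewrite trmx_mul trmxK.
Qed.

(** The projector onto the span of the columns is updated by the rank-one
    projector on the component w of the new column that is orthogonal to the
    previous ones. As 0^-1 = 0, nothing is added when w = 0, so that linearly
    dependent columns need no separate case and the result is visibly a Borel
    function of the entries. *)
Fixpoint gram_schmidt n p : 'M[R]_(n, p) -> 'M[R]_n :=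
  if p is p'.+1 then fun M : 'M[R]_(n, 1 + p') =>
    let Q := gram_schmidt (rsubmx M) in
    let w := lsubmx M - Q *m lsubmx M in
    Q + (sqnorm w)^-1 *: (w *m w^T)
  else fun=> 0.

Lemma gram_schmidtP n p (M : 'M[R]_(n, p)) : is_orth_proj M (gram_schmidt M).
Proof.
elim: p M => [|p IH] M /=.
  apply: is_orth_projP; rewrite ?trmx0 ?mul0mx // ?[M]thinmx0 //.
  by exists 0; rewrite mulmx0.
pose M1 : 'M[R]_(n, 1 + p) := M; rewrite -/M1.
set Q := gram_schmidt _; set v := lsubmx M1; set w := v - Q *m v.
have QP : is_orth_proj (rsubmx M1) Q by exact: IH.
have [sQ iQ _] := QP; have QM := is_orth_proj_id QP.
have [Y QY] := is_orth_proj_range QP.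
have Qw : Q *m w = 0 by rewrite /w mulmxBr mulmxA iQ subrr.
have wQ : w^T *m Q = 0 by rewrite -[Q]sQ -trmx_mul Qw trmx0.
have ww (u : 'cV[R]_n) k (N : 'M[R]_(k,1)) :
    N *m w^T *m u = bform 1%:M w u *: N.
  by rewrite -mulmxA (mx11_scalar (w^T *m u)) mul_mx_scalar /bform mulmx1.
pose W := (sqnorm w)^-1 *: (w *m w^T); rewrite -/W.
have WT : W^T = W by rewrite linearZ /= trmx_mul trmxK.
have QW : Q *m W = 0 by rewrite -scalemxAr mulmxA Qw mul0mx scaler0.
have WQ : W *m Q = 0 by rewrite -scalemxAl -mulmxA wQ mulmx0 scaler0.
have WW : W *m W = W.
  rewrite -scalemxAl -scalemxAr mulmxA ww -scalemxAl !scalerA.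
  congr (_ *: _); rewrite bform1.
  have [->|w0] := eqVneq (sqnorm w) 0; first by rewrite invr0 !mul0r.
  by field.
have Wv : W *m v = w.
  have -> : v = w + Q *m v by rewrite subrK.
  rewrite mulmxDr mulmxA WQ mul0mx addr0 -scalemxAl ww bform1 scalerA.
  have [/eqP w0|w0] := eqVneq (sqnorm w) 0; last by rewrite mulVf ?scale1r.
  by move: w0; rewrite sqnorm_eq0 => /eqP ->; rewrite scaler0.
rewrite -[M1]hsubmxK -/v; apply: (@is_orth_projP n (1 + p)).
- by rewrite linearD /= sQ WT.
- by rewrite mulmxDl !mulmxDr iQ QW WQ WW addr0 add0r.
- rewrite mul_mx_row !mulmxDl Wv QM addrC subrK.
  by rewrite -[in W *m _]QM mulmxA WQ mul0mx addr0.
- exists (col_mx ((sqnorm w)^-1 *: w^T) (Y - (sqnorm w)^-1 *: (Y *m v *m w^T))).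
  rewrite mul_row_col mulmxBr -QY -scalemxAr.
  rewrite -scalemxAr !mulmxA -QY addrCA -scalerBr -mulmxBl //.
Qed.

Lemma orth_projP m n (M : 'M[R]_(m, n)) : is_orth_proj M (orth_proj M).
Proof. by rewrite (orth_projE (gram_schmidtP M)); exact: gram_schmidtP. Qed.

Lemma orth_proj_gram_schmidt m n (M : 'M[R]_(m, n)) :
  orth_proj M = gram_schmidt M.
Proof. exact: orth_projE (gram_schmidtP M). Qed.

Lemma orth_proj_sym m n (M : 'M[R]_(m, n)) : (orth_proj M)^T = orth_proj M.
Proof. by have [] := orth_projP M. Qed.

Lemma orth_proj_idem m n (M : 'M[R]_(m, n)) :
  orth_proj M *m orth_proj M = orth_proj M.
Proof. by have [] := orth_projP M. Qed.

(** With Q = M Y the projector on the column space and P = Z M the one on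
    the row space, P Y Q satisfies the Penrose equations. *)
Lemma mp_pinv_exists m n (M : 'M[R]_(m, n)) : exists X, is_mp_pinv M X.
Proof.
have [sQ iQ _] := orth_projP M; have QM := is_orth_proj_id (orth_projP M).
have [Y QY] := is_orth_proj_range (orth_projP M).
have [sP iP _] := orth_projP M^T; have PM := is_orth_proj_id (orth_projP M^T).
have [Z PZ] := is_orth_proj_range (orth_projP M^T).
set Q := orth_proj M in sQ iQ QM QY; set P := orth_proj M^T in sP iP PM PZ.
have {}PM : M *m P = M by apply: trmx_inj; rewrite trmx_mul sP.
have {}PZ : P = Z^T *m M by rewrite -[LHS]sP PZ trmx_mul trmxK.
pose X := P *m Y *m Q.
have MX : M *m X = Q by rewrite /X !mulmxA PM -QY iQ.
have XM : X *m M = P.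
  by rewrite /X -!mulmxA QM {1}PZ -mulmxA (mulmxA M) -QY QM -PZ.
exists X; split; rewrite ?MX ?XM //.
by rewrite /X !mulmxA iP.
Qed.

Lemma mp_pinvP m n (M : 'M[R]_(m, n)) : is_mp_pinv M (mp_pinv M).
Proof.
have [X XP] := mp_pinv_exists M.
by rewrite /mp_pinv; case: xgetP => [//|/(_ X)[]].
Qed.

(** This turns the sketched update of the method into an orthogonal projection
    of the error. *)
Lemma mp_pinv_mul m n (M : 'M[R]_(m, n)) : mp_pinv M *m M = orth_proj M^T.
Proof.
have [MXM XMX _ sXM] := mp_pinvP M; apply/esym/orth_projE/is_orth_projP => //.
- by rewrite mulmxA XMX.
- by rewrite -{1}sXM -trmx_mul mulmxA MXM.
- by exists (mp_pinv M)^T; rewrite -trmx_mul sXM.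
Qed.

Definition is_projector n (H : 'M[R]_n) := H^T = H /\ H *m H = H.

Lemma projector_qform n (H : 'M[R]_n) v : is_projector H ->
  qform H v = sqnorm (H *m v).
Proof.
move=> [sH iH].
transitivity (bform H (H^T *m v) v); first by rewrite -bform_mull iH.
by rewrite sH /sqnorm /qform -bform_mul mul1mx.
Qed.

Lemma projector_sqnorm_sub n (H : 'M[R]_n) v : is_projector H ->
  sqnorm (v - H *m v) = sqnorm v - qform H v.
Proof.
move=> pH; have vH : bform 1%:M v (H *m v) = qform H v.
  by rewrite -bform_mul mul1mx.
rewrite /sqnorm /qform !bformD (bformC (H *m v) v) ?trmx1 // vH.
by rewrite !bform1 -projector_qform // /qform; lra.
Qed.

Lemma projector_qform_le n (H : 'M[R]_n) v : is_projector H ->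
  0 <= qform H v <= sqnorm v.
Proof.
move=> pH; rewrite {1}projector_qform // sqnorm_ge0 /=.
by rewrite -subr_ge0 -projector_sqnorm_sub // sqnorm_ge0.
Qed.

Lemma projector_entry_bound n (H : 'M[R]_n) i j : is_projector H ->
  `|H i j| <= 1.
Proof.
move=> pH; have := projector_qform_le (delta_mx j 0) pH.
rewrite sqnorm_delta projector_qform // -colE => /andP[_ /(le_trans _)] Hj.
have /Hj := sqr_entry_le (col j H) i; rewrite mxE -[leRHS](expr1n R 2).
by rewrite -real_normK ?num_real // ler_sqr ?nnegrE.
Qed.

End Projectors.

(** * Measurability and expectation of random matrices *)

Section RandomMatrices.
Context {R : realType} {d : measure_display} {T : measurableType d}.

Lemma random_mx_cst m n (M : 'M[R]_(m, n)) : random_mx (fun _ : T => M).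
Proof. by move=> i j; exact: measurable_cst. Qed.

Lemma random_mxD m n (X Y : T -> 'M[R]_(m, n)) :
  random_mx X -> random_mx Y -> random_mx (fun w => X w + Y w).
Proof.
by move=> mX mY i j; under eq_fun do rewrite mxE; exact: measurable_funD.
Qed.

Lemma random_mxN m n (X : T -> 'M[R]_(m, n)) :
  random_mx X -> random_mx (fun w => - X w).
Proof.
by move=> mX i j; under eq_fun do rewrite mxE; exact: measurableT_comp.
Qed.

Lemma random_mxZ m n (a : T -> R) (X : T -> 'M[R]_(m, n)) :
  measurable_fun setT a -> random_mx X -> random_mx (fun w => a w *: X w).
Proof.
by move=> ma mX i j; under eq_fun do rewrite mxE; exact: measurable_funM.
Qed.

Lemma random_mxM m n p (X : T -> 'M[R]_(m, n)) (Y : T -> 'M[R]_(n, p)) :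
  random_mx X -> random_mx Y -> random_mx (fun w => X w *m Y w).
Proof.
move=> mX mY i j; under eq_fun do rewrite mxE.
by apply: measurable_sum => k; exact: measurable_funM.
Qed.

Lemma random_mx_tr m n (X : T -> 'M[R]_(m, n)) :
  random_mx X -> random_mx (fun w => (X w)^T).
Proof. by move=> mX i j; under eq_fun do rewrite mxE; exact: mX. Qed.

Lemma measurable_bform n (X : T -> 'M[R]_n) (u v : T -> 'cV[R]_n) :
  random_mx X -> random_mx u -> random_mx v ->
  measurable_fun setT (fun w => bform (X w) (u w) (v w)).
Proof.
move=> mX mu mv; apply: random_mxM => //; apply: random_mxM => //.
exact: random_mx_tr.
Qed.

Lemma measurable_sqnorm n (v : T -> 'cV[R]_n) :
  random_mx v -> measurable_fun setT (fun w => sqnorm (v w)).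
Proof. by move=> mv; apply: measurable_bform => //; exact: random_mx_cst. Qed.

Lemma random_gram_schmidt n p (M : T -> 'M[R]_(n, p)) :
  random_mx M -> random_mx (fun w => gram_schmidt (M w)).
Proof.
elim: p M => [|p IH] M mM /=; first exact: random_mx_cst.
pose M1 w : 'M[R]_(n, 1 + p) := M w.
have mQ : random_mx (fun w => gram_schmidt (rsubmx (M1 w))).
  by apply: IH => i j; under eq_fun do rewrite mxE; exact: mM.
have mv : random_mx (fun w => lsubmx (M1 w)).
  by move=> i j; under eq_fun do rewrite mxE; exact: mM.
have mw : random_mx (fun w => lsubmx (M1 w) -
    gram_schmidt (rsubmx (M1 w)) *m lsubmx (M1 w)).
  by apply: random_mxD => //; apply/random_mxN/random_mxM.
apply: random_mxD => //; apply: random_mxZ; last first.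
  by apply: random_mxM => //; exact: random_mx_tr.
(* powR agrees with the inverse at 0 as well *)
under eq_fun do rewrite -powR_inv1 ?sqnorm_ge0 //.
by apply: (measurableT_comp (measurable_powR _)); exact: measurable_sqnorm.
Qed.

(** The projector is discontinuous where the rank drops, so its measurability
    comes from the explicit Gram-Schmidt formula. *)
Lemma random_orth_proj n p (M : T -> 'M[R]_(n, p)) :
  random_mx M -> random_mx (fun w => orth_proj (M w)).
Proof.
move=> mM; under eq_fun do rewrite orth_proj_gram_schmidt.
exact: random_gram_schmidt.
Qed.

Variable P : probability T R.

(** Entries of projectors are at most 1 in absolute value, so every random
    variable whose mean has to be expanded by linearity is bounded, hence
    integrable. *)
Definition bounded_rv (f : T -> R) :=
  measurable_fun setT f /\ exists C, forall w, `|f w| <= C.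

Definition bounded_mx m n (X : T -> 'M[R]_(m, n)) :=
  forall i j, bounded_rv (fun w => X w i j).

Definition mean (f : T -> R) : R := fine 'E_P[f].

Lemma bounded_rvD f g : bounded_rv f -> bounded_rv g ->
  bounded_rv (fun w => f w + g w).
Proof.
move=> [mf [C hC]] [mg [D hD]]; split; first exact: measurable_funD.
exists (C + D) => w; apply: (le_trans (ler_normD _ _)); exact: lerD.
Qed.

Lemma bounded_rvM f g : bounded_rv f -> bounded_rv g ->
  bounded_rv (fun w => f w * g w).
Proof.
move=> [mf [C hC]] [mg [D hD]]; split; first exact: measurable_funM.
by exists (C * D) => w; rewrite normrM; apply: ler_pM.
Qed.

Lemma bounded_rv_cst c : bounded_rv (fun=> c).
Proof. by split; [exact: measurable_cst|exists `|c|]. Qed.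

Lemma bounded_rv_sum (I : Type) (s : seq I) (f : I -> T -> R) :
  (forall i, bounded_rv (f i)) -> bounded_rv (fun w => \sum_(i <- s) f i w).
Proof.
move=> bf; elim: s => [|i s IH].
  by under eq_fun do rewrite big_nil; exact: bounded_rv_cst.
by under eq_fun do rewrite big_cons; exact: bounded_rvD.
Qed.

Lemma bounded_mx_cst m n (M : 'M[R]_(m, n)) : bounded_mx (fun=> M).
Proof. by move=> i j; exact: bounded_rv_cst. Qed.

Lemma bounded_mxM m n p (X : T -> 'M[R]_(m, n)) (Y : T -> 'M[R]_(n, p)) :
  bounded_mx X -> bounded_mx Y -> bounded_mx (fun w => X w *m Y w).
Proof.
move=> bX bY i j; under eq_fun do rewrite mxE.
by apply: bounded_rv_sum => k; exact: bounded_rvM.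
Qed.

Lemma bounded_bform n (X : T -> 'M[R]_n) u v :
  bounded_mx X -> bounded_rv (fun w => bform (X w) u v).
Proof.
by move=> bX; apply: bounded_mxM; [apply: bounded_mxM| ] => //; exact: bounded_mx_cst.
Qed.

Lemma bounded_rv_Lfun f : bounded_rv f -> f \in Lfun P 1.
Proof.
move=> [mf [C hC]]; apply/Lfun1_integrable; apply: measurable_bounded_integrable => //.
  by rewrite (le_lt_trans (probability_le1 P measurableT)) ?ltry.
exists C; split; first exact: num_real.
by move=> x Cx w _; exact: le_trans (hC w) (ltW Cx).
Qed.

Lemma meanE f : bounded_rv f -> 'E_P[f]%E = (mean f)%:E.
Proof. by move=> bf; rewrite fineK // expectation_fin_num // bounded_rv_Lfun. Qed.

Lemma meanD f g : bounded_rv f -> bounded_rv g ->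
  mean (fun w => f w + g w) = mean f + mean g.
Proof.
move=> bf bg; rewrite /mean (@expectationD _ _ _ _ f g) ?bounded_rv_Lfun //.
by rewrite fineD // expectation_fin_num // bounded_rv_Lfun.
Qed.

Lemma meanZ f c : bounded_rv f -> mean (fun w => c * f w) = c * mean f.
Proof.
move=> bf; rewrite /mean (_ : (fun w => _) = c \o* f); last first.
  by apply/funext => w /=; rewrite mulrC.
by rewrite expectationZl ?bounded_rv_Lfun // meanE.
Qed.

Lemma mean_cst c : mean (fun=> c) = c.
Proof. by rewrite /mean expectation_cst. Qed.

Lemma mean_sum (I : Type) (s : seq I) (f : I -> T -> R) :
  (forall i, bounded_rv (f i)) ->
  mean (fun w => \sum_(i <- s) f i w) = \sum_(i <- s) mean (f i).
Proof.
move=> bf; elim: s => [|i s IH].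
  by under eq_fun do rewrite big_nil; rewrite big_nil mean_cst.
under eq_fun do rewrite big_cons; rewrite big_cons meanD ?IH //.
exact: bounded_rv_sum.
Qed.

Lemma mean_ge0 f : (forall w, 0 <= f w) -> 0 <= mean f.
Proof. by move=> f0; rewrite fine_ge0 // expectation_ge0. Qed.

Lemma mean_le f g : bounded_rv f -> bounded_rv g ->
  (forall w, f w <= g w) -> mean f <= mean g.
Proof.
move=> bf bg fg; have bNf : bounded_rv (fun w => -1 * f w).
  by apply: bounded_rvM => //; exact: bounded_rv_cst.
have : 0 <= mean (fun w => g w + -1 * f w).
  by apply: mean_ge0 => w; rewrite mulN1r subr_ge0.
by rewrite meanD // meanZ // mulN1r subr_ge0.
Qed.

Lemma mean_bform n (X : T -> 'M[R]_n) u v : bounded_mx X ->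
  mean (fun w => bform (X w) u v) = bform (expect_mx P X) u v.
Proof.
move=> bX; under eq_fun do rewrite bformE.
have bu i j : bounded_rv (fun w => u i 0 * X w i j * v j 0).
  apply: bounded_rvM; last exact: bounded_rv_cst.
  by apply: bounded_rvM => //; exact: bounded_rv_cst.
rewrite bformE mean_sum => [|i]; last exact: bounded_rv_sum.
apply: eq_bigr => i _; rewrite mean_sum //; apply: eq_bigr => j _.
under eq_fun do rewrite mulrAC.
by rewrite meanZ // mulrAC mxE.
Qed.

Lemma expect_mx_conj n (X : T -> 'M[R]_n) (K L : 'M[R]_n) : bounded_mx X ->
  expect_mx P (fun w => K *m X w *m L) = K *m expect_mx P X *m L.
Proof.
have entry (M : 'M[R]_n) i j :
    (K *m M *m L) i j = bform M (row i K)^T (col j L).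
  rewrite /bform trmxK -row_mul mxE [RHS]mxE; apply: eq_bigr => k _.
  by rewrite [col _ _ _ _]mxE [row _ _ _ _]mxE.
move=> bX; apply/matrixP => i j; rewrite entry -mean_bform // mxE.
by congr fine; congr expectation; apply/funext => w; rewrite entry.
Qed.

End RandomMatrices.

(** * One step of the method *)

Section OneStep.
Context {R : realType} {d : measure_display} {T : measurableType d}.
Variables (P : probability T R) (n : nat) (H : T -> 'M[R]_n).
Hypothesis mH : random_mx H.
Hypothesis projH : forall w, is_projector (H w).

Let G := expect_mx P H.
Let mu := lambda_min G.
Let B := psd_sqrt G.
Let K := invmx B.
Let nu := lambda_max (expect_mx P (fun w => (K *m H w *m K) ^+ 2)).
Let tau := Num.sqrt (mu / nu).
Let E2 := expect_mx P (fun w => H w *m invmx G *m H w).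

Hypothesis mu_gt0 : 0 < mu.

Lemma bounded_projector : bounded_mx H.
Proof.
by move=> i j; split; [exact: mH|exists 1 => w; exact: projector_entry_bound].
Qed.
Let bH := bounded_projector.

Lemma dim_gt0 : (0 < n)%N.
Proof.
rewrite lt0n; apply/negP => /eqP n0; move: mu_gt0; rewrite /mu /G.
by move: (expect_mx P H); rewrite n0 => M; rewrite lambda_min0 ltxx.
Qed.

Lemma unit_vector : exists v : 'cV[R]_n, sqnorm v = 1.
Proof. by exists (delta_mx (Ordinal dim_gt0) 0); exact: sqnorm_delta. Qed.

Lemma expect_projector_sym : G^T = G.
Proof.
apply/matrixP => i j; rewrite !mxE; congr fine; congr expectation.
by apply/funext => w; rewrite -{1}(projH w).1 mxE.
Qed.
Let sG := expect_projector_sym.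

Lemma qform_expect v : qform G v = mean P (fun w => qform (H w) v).
Proof. by rewrite /qform mean_bform. Qed.

Lemma expect_projector_coercive v : mu * sqnorm v <= qform G v.
Proof.
have := sG; rewrite /mu; move: (G) v; rewrite -(prednK dim_gt0) => M v.
exact: lambda_minP.
Qed.

Lemma expect_projector_psd : psdmx G.
Proof.
split=> // v; apply: (le_trans _ (expect_projector_coercive v)).
by rewrite mulr_ge0 ?sqnorm_ge0 // ltW.
Qed.

Lemma expect_projector_le v : qform G v <= sqnorm v.
Proof.
rewrite qform_expect -[leRHS](mean_cst P); apply: mean_le => [||w].
- exact: bounded_bform.
- exact: bounded_rv_cst.
- by have /andP[] := projector_qform_le v (projH w).
Qed.

Lemma expect_projector_unit : G \in unitmx.
Proof.
rewrite -row_free_unit -kermx_eq0; apply/eqP/row_matrixP => i.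
rewrite row0; set u := row i _; have uG : u *m G = 0.
  by rewrite /u -row_mul mulmx_ker row0.
apply: trmx_inj; rewrite trmx0; apply/eqP; rewrite -sqnorm_eq0.
rewrite eq_le sqnorm_ge0 andbT -(pmulr_rle0 _ mu_gt0).
apply: (le_trans (expect_projector_coercive _)).
by rewrite /qform /bform trmxK uG mul0mx mxE.
Qed.
Let uG := expect_projector_unit.

Let sB : B^T = B. Proof. exact: (psd_sqrtP expect_projector_psd).1.1. Qed.
Let BB : B *m B = G. Proof. exact: (psd_sqrtP expect_projector_psd).2. Qed.
Let uB : B \in unitmx.
Proof. by move: uG; rewrite -BB unitmx_mul andbb. Qed.
Let sK : K^T = K. Proof. by rewrite trmx_inv sB. Qed.
Let KK : K *m K = invmx G.
Proof.
have KKG : K *m K *m G = 1%:M.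
  by rewrite -BB !mulmxA -[K *m K *m B]mulmxA mulVmx // mulmx1 mulVmx.
by rewrite -[LHS]mulmx1 -(mulmxV uG) mulmxA KKG mul1mx.
Qed.
Let KGK : K *m G *m K = 1%:M.
Proof. by rewrite -BB !mulmxA mulVmx // mul1mx mulmxV. Qed.
Let sGi : (invmx G)^T = invmx G. Proof. by rewrite trmx_inv sG. Qed.

Lemma qform_inv v : qform (invmx G) v = sqnorm (K *m v).
Proof.
transitivity (bform K (K^T *m v) v); first by rewrite -bform_mull KK.
by rewrite sK /sqnorm /qform -bform_mul mul1mx.
Qed.

Lemma qform_inv_ge0 v : 0 <= qform (invmx G) v.
Proof. by rewrite qform_inv sqnorm_ge0. Qed.

(** From mu <= G one gets G^-1 <= 1 / mu. *)
Lemma qform_inv_le v : mu * qform (invmx G) v <= sqnorm v.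
Proof.
rewrite qform_inv; apply: (le_trans (expect_projector_coercive _)).
suff -> : qform G (K *m v) = sqnorm v by [].
transitivity (bform (G *m K) (K^T *m v) v); first by rewrite sK bform_mul.
by rewrite -bform_mull mulmxA KGK.
Qed.

Let bE2 : bounded_mx (fun w => H w *m invmx G *m H w).
Proof. by apply: bounded_mxM => //; apply: bounded_mxM => //; exact: bounded_mx_cst. Qed.

Let KHK2 w : (K *m H w *m K) ^+ 2 = K *m (H w *m invmx G *m H w) *m K.
Proof. by rewrite expr2 -mulmxE -KK !mulmxA. Qed.

Let sE : (K *m E2 *m K)^T = K *m E2 *m K.
Proof.
rewrite !trmx_mul sK mulmxA; congr (_ *m _ *m _).
apply/matrixP => i j; rewrite !mxE; congr fine; congr expectation.
apply/funext => w.
have sX : (H w *m invmx G *m H w)^T = H w *m invmx G *m H w.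
  by rewrite !trmx_mul sGi (projH w).1 mulmxA.
by rewrite -[in LHS]sX [LHS]mxE.
Qed.

Let qE2 v : qform (K *m E2 *m K) v <= nu * sqnorm v.
Proof.
have -> : nu = lambda_max (K *m E2 *m K).
  rewrite /nu -expect_mx_conj //; congr (lambda_max (expect_mx _ _)).
  by apply/funext => w.
have := sE; move: (K *m E2 *m K) v; rewrite -(prednK dim_gt0) => M v.
exact: lambda_maxP.
Qed.

(** The definition of nu says K E[H G^-1 H] K <= nu; conjugating by
    B = G^(1/2) gives E[H G^-1 H] <= nu G, the only property of nu, besides
    nu >= 1, on which the rate relies. *)
Lemma expect_sandwich_le v : qform E2 v <= nu * qform G v.
Proof.
have -> : qform G v = sqnorm (B *m v).
  transitivity (bform B (B^T *m v) v); first by rewrite -bform_mull BB.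
  by rewrite sB /sqnorm /qform -bform_mul mul1mx.
suff <- : qform (K *m E2 *m K) (B *m v) = qform E2 v by exact: qE2.
transitivity (bform (K *m E2 *m K *m B) (B^T *m v) v).
  by rewrite sB bform_mul.
by rewrite -bform_mull !mulmxA mulmxV // mul1mx -mulmxA mulVmx // mulmx1.
Qed.

(** The random matrix K H K has mean 1, so its second moment is at least 1:
    expand the mean of the square of K H K - 1. *)
Lemma nu_ge1 : 1 <= nu.
Proof.
have [v v1] := unit_vector.
have := qE2 v; rewrite v1 mulr1 => /(le_trans _); apply.
have qE w : qform (K *m (H w *m invmx G *m H w) *m K) v
          = sqnorm (K *m H w *m K *m v).
  have sX : (K *m H w *m K)^T = K *m H w *m K.
    by rewrite !trmx_mul sK (projH w).1 mulmxA.
  rewrite -KHK2 expr2 -mulmxE; set X := K *m H w *m K in sX *.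
  transitivity (bform X (X^T *m v) v); first by rewrite -bform_mull.
  by rewrite sX /sqnorm /qform -bform_mul mul1mx.
have q1 : mean P (fun w => qform (K *m H w *m K) v) = 1.
  rewrite /qform mean_bform; last first.
    by apply: bounded_mxM; [apply: bounded_mxM| ] => //; exact: bounded_mx_cst.
  by rewrite expect_mx_conj // KGK.
have bK : bounded_mx (fun w => K *m H w *m K).
  by apply: bounded_mxM; [apply: bounded_mxM| ] => //; exact: bounded_mx_cst.
have bK2 : bounded_mx (fun w => K *m (H w *m invmx G *m H w) *m K).
  by apply: bounded_mxM; [apply: bounded_mxM| ] => //; exact: bounded_mx_cst.
rewrite -expect_mx_conj // /qform -mean_bform //.
have -> : 1 = mean P (fun w => 2 * qform (K *m H w *m K) v + -1).
  rewrite meanD ?meanZ ?mean_cst ?q1; [lra|exact: bounded_bform| | ].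
    by apply: bounded_rvM; [exact: bounded_rv_cst|exact: bounded_bform].
  exact: bounded_rv_cst.
apply: mean_le => [||w].
- apply: bounded_rvD; last exact: bounded_rv_cst.
  by apply: bounded_rvM; [exact: bounded_rv_cst|exact: bounded_bform].
- exact: bounded_bform.
rewrite -/(qform _ v) qE.
have := sqnorm_ge0 (v - K *m H w *m K *m v).
rewrite /sqnorm /qform !bformD (bformC (_ *m v) v) ?trmx1 //.
by rewrite -bform_mul mul1mx !bform1 v1; lra.
Qed.

Lemma mu_le1 : mu <= 1.
Proof.
have [v v1] := unit_vector; have := expect_projector_coercive v.
by rewrite v1 mulr1 => /le_trans; apply; rewrite -v1 expect_projector_le.
Qed.

Lemma tau_gt0 : 0 < tau.
Proof. by rewrite sqrtr_gt0 divr_gt0 // (lt_le_trans _ nu_ge1). Qed.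

Lemma sqr_tau : tau ^+ 2 * nu = mu.
Proof.
have nu0 : 0 < nu by exact: lt_le_trans nu_ge1.
by rewrite sqr_sqrtr ?divfK ?gt_eqF // divr_ge0 // ltW.
Qed.

Lemma tau_le1 : tau <= 1.
Proof.
have nu0 : 0 < nu by exact: lt_le_trans nu_ge1.
rewrite -(sqrtr1 R) ler_wsqrtr // ler_pdivrMr // mul1r.
exact: le_trans mu_le1 nu_ge1.
Qed.

(** The Lyapunov function of the accelerated method. In the inner product of
    G^-1, pairing with the mean G x of the random direction H x is the Euclidean
    pairing with x. *)
Definition potential (y z : 'cV[R]_n) := qform (invmx G) z + mu^-1 * sqnorm y.

Lemma potential_ge0 y z : 0 <= potential y z.
Proof.
by rewrite addr_ge0 ?qform_inv_ge0 // mulr_ge0 ?sqnorm_ge0 // invr_ge0 ltW.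
Qed.

Lemma potential_diag_le v : potential v v <= 2 * mu^-1 * sqnorm v.
Proof.
have := qform_inv_le v; rewrite -ler_pdivlMl // /potential; lra.
Qed.

Definition extrapolation (y z : 'cV[R]_n) :=
  (1 + tau)^-1 *: y + (tau / (1 + tau)) *: z.

Definition next_y (h : 'M[R]_n) y z :=
  extrapolation y z - h *m extrapolation y z.

Definition next_z (h : 'M[R]_n) y z :=
  z + tau *: (extrapolation y z - z)
    - (tau / mu) *: (h *m extrapolation y z).

Lemma qform_subZ (M : 'M[R]_n) u v a : M^T = M ->
  qform M (u - a *: v) = qform M u - 2 * a * bform M u v + a ^+ 2 * qform M v.
Proof. by move=> sM; rewrite /qform !bformD (bformC v u sM); ring. Qed.

(** With x = (y + tau z) / (1 + tau) and c = (1 - tau) z + tau x, taking means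
    in the expansion of the new potential leaves
    |c|^2_{G^-1} - (2 tau / mu) x^T c + |x|^2 / mu, plus the term
    (tau / mu)^2 x^T E[H G^-1 H] x - x^T G x / mu, which is nonpositive since
    tau^2 nu = mu. Convexity bounds |c|^2_{G^-1} by
    (1 - tau) |z|^2_{G^-1} + tau |x|^2 / mu, and
    tau x^T c = |x|^2 - (1 - tau) x^T y with 2 x^T y <= |x|^2 + |y|^2 makes the
    coefficients of |x|^2 cancel. The equality in the statement records that
    the expectation is finite. *)
Lemma mean_potential_le y z :
  'E_P[fun w => potential (next_y (H w) y z) (next_z (H w) y z)]%E
     = (mean P (fun w => potential (next_y (H w) y z) (next_z (H w) y z)))%:E
  /\ mean P (fun w => potential (next_y (H w) y z) (next_z (H w) y z))
     <= (1 - tau) * potential y z.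
Proof.
have t0 := tau_gt0; have t1 := tau_le1; have tn := sqr_tau.
set x := extrapolation y z; set c := z + tau *: (x - z).
set s := tau / mu.
pose f w := (qform (invmx G) c + mu^-1 * sqnorm x)
  + (- (2 * s) * bform (H w) x (invmx G *m c)
  + (s ^+ 2 * qform (H w *m invmx G *m H w) x + - mu^-1 * qform (H w) x)).
have -> : (fun w => potential (next_y (H w) y z) (next_z (H w) y z)) = f.
  apply/funext => w; rewrite /potential /next_y /next_z -/x -/c -/s.
  rewrite projector_sqnorm_sub // /f qform_subZ //.
  have -> : bform (invmx G) c (H w *m x) = bform (H w) x (invmx G *m c).
    by rewrite (bformC c) // -{1}(projH w).1 -bform_mull bform_mul.
  have -> : qform (invmx G) (H w *m x) = qform (H w *m invmx G *m H w) x.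
    by rewrite [RHS]/qform -mulmxA bform_mull (projH w).1 bform_mul.
  ring.
have bf1 : bounded_rv (fun w => - (2 * s) * bform (H w) x (invmx G *m c)).
  by apply: bounded_rvM; [exact: bounded_rv_cst|exact: bounded_bform].
have bf2 : bounded_rv (fun w => s ^+ 2 * qform (H w *m invmx G *m H w) x).
  by apply: bounded_rvM; [exact: bounded_rv_cst|exact: bounded_bform].
have bf3 : bounded_rv (fun w => - mu^-1 * qform (H w) x).
  by apply: bounded_rvM; [exact: bounded_rv_cst|exact: bounded_bform].
have bf23 := bounded_rvD bf2 bf3; have bf123 := bounded_rvD bf1 bf23.
have bf := bounded_rvD (bounded_rv_cst (qform (invmx G) c + mu^-1 * sqnorm x)) bf123.
split; first exact: meanE.
rewrite /f meanD //; last exact: bounded_rv_cst.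
rewrite mean_cst meanD // meanD // meanZ; last exact: bounded_bform.
rewrite meanZ; last exact: bounded_bform.
rewrite meanZ; last exact: bounded_bform.
rewrite /qform !mean_bform // -/G -/E2 -!/(qform _ _) -bform_mul mulmxV //.
have yE : y = (1 + tau) *: x - tau *: z.
  rewrite /x /extrapolation scalerDr !scalerA.
  rewrite mulfV ?gt_eqF ?addr_gt0 // scale1r mulrC.
  by rewrite divfK ?addrK // gt_eqF ?addr_gt0.
clearbody x; set E := qform E2 x; set g := qform G x.
have sX : s ^+ 2 * E <= mu^-1 * g.
  apply: (le_trans (ler_wpM2l (sqr_ge0 _) (expect_sandwich_le x))).
  rewrite mulrA (_ : s ^+ 2 * nu = mu^-1) //.
  rewrite /s exprMn exprVn mulrAC tn expr2 invfM mulrA divff ?mul1r //.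
  by rewrite gt_eqF.
have cvx : qform (invmx G) c <=
    (1 - tau) * qform (invmx G) z + tau * qform (invmx G) x.
  have tt : 0 <= tau * (1 - tau) by rewrite mulr_ge0 ?subr_ge0 // ltW.
  have := mulr_ge0 tt (qform_inv_ge0 (x - z)).
  by rewrite /c /qform !bformD (bformC z x) //; lra.
have Gx : qform (invmx G) x <= mu^-1 * sqnorm x.
  by rewrite ler_pdivlMl // qform_inv_le.
have sc : s * bform 1%:M x c
        = mu^-1 * (sqnorm x - (1 - tau) * bform 1%:M x y).
  rewrite yE /s /c !bformD bform1; ring.
have xy : 2 * bform 1%:M x y <= sqnorm x + sqnorm y.
  have := sqnorm_ge0 (x - y).
  by rewrite /sqnorm /qform !bformD (bformC y x) ?trmx1 //; lra.
have mi : 0 < mu^-1 by rewrite invr_gt0.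
have {}xy : mu^-1 * (1 - tau) * (2 * bform 1%:M x y)
    <= mu^-1 * (1 - tau) * (sqnorm x + sqnorm y).
  by rewrite ler_wpM2l // mulr_ge0 ?subr_ge0 // ltW.
have {}Gx : tau * qform (invmx G) x <= tau * (mu^-1 * sqnorm x).
  by rewrite ler_wpM2l // ltW.
rewrite /potential; lra.
Qed.

End OneStep.

(** * Independence *)

Section Freezing.
Context {R : realType} {d d1 d2 : measure_display} {T : measurableType d}.
Context {T1 : measurableType d1} {T2 : measurableType d2}.
Variable P : probability T R.

(** By uniqueness of product measures the joint law of U and V is the product
    of the laws of U and V', so that Tonelli's theorem allows integrating first
    over V with the value of U frozen. *)
Lemma integral_independent_le (U : T -> T1) (V V' : T -> T2)
    (f : T1 * T2 -> \bar R) (g : T1 -> \bar R) :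
  measurable_fun setT U -> measurable_fun setT V -> measurable_fun setT V' ->
  (forall C D, measurable C -> measurable D ->
    P ((U @^-1` C) `&` (V @^-1` D)) = (P (U @^-1` C) * P (V @^-1` D))%E) ->
  (forall D, measurable D -> P (V @^-1` D) = P (V' @^-1` D)) ->
  measurable_fun setT f -> (forall u, (0 <= f u)%E) ->
  measurable_fun setT g ->
  (forall u, \int[P]_w f (u, V' w) <= g u)%E ->
  (\int[P]_w f (U w, V w) <= \int[P]_w g (U w))%E.
Proof.
move=> mU mV mV' indep law mf f0 mg fg.
have g0 u : (0 <= g u)%E.
  by apply: le_trans (fg u); exact: integral_ge0.
pose U1 : {mfun T >-> T1} := HB.pack U (isMeasurableFun.Build _ _ _ _ U mU).
pose V1 : {mfun T >-> T2} := HB.pack V' (isMeasurableFun.Build _ _ _ _ V' mV').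
pose W w := (U w, V w).
have mW : measurable_fun setT W by exact: measurable_fun_pair.
pose W1 : {mfun T >-> (T1 * T2)%type} :=
  HB.pack W (isMeasurableFun.Build _ _ _ _ W mW).
have -> : (\int[P]_w f (U w, V w) = \int[distribution P W1]_u f u)%E.
  by rewrite ge0_integral_distribution.
have -> : (\int[distribution P W1]_u f u =
    \int[(distribution P U1 \x distribution P V1)]_u f u)%E.
  apply/esym; apply: eq_measure_integral => A mA _.
  apply: product_measure_unique => // C D mC mD.
  by have := indep C D mC mD; rewrite (law D mD).
have -> : (\int[P]_w g (U w) = \int[distribution P U1]_u g u)%E.
  by rewrite ge0_integral_distribution.
rewrite fubini_tonelli1 //; apply: ge0_le_integral => //.
- by move=> u _; exact: integral_ge0.
- exact: measurable_fun_fubini_tonelli_F.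
move=> u _; rewrite /fubini_F ge0_integral_distribution //; first exact: fg.
exact: (measurableT_comp mf (pair1_measurable _)).
Qed.

End Freezing.

Section Borel.
Context {R : realType}.

Definition entry_preimages m n : set (set 'M[R]_(m, n)) :=
  [set C | exists i j, exists2 B : set R,
     measurable B & C = [set M : 'M[R]_(m, n) | B (M i j)]].

Definition borel_matrix m n := g_sigma_algebraType (@entry_preimages m n).

Lemma measurable_borel_matrix m n d (T : measurableType d)
    (X : T -> 'M[R]_(m, n)) :
  random_mx X -> measurable_fun setT (X : T -> borel_matrix m n).
Proof.
move=> mX.
apply: (@measurability _ _ T (borel_matrix m n) setT X (@entry_preimages m n)).
  by [].
move=> _ [_ [i [j [B mB ->]]] <-]; exact: mX.
Qed.

Lemma random_mx_id m n : random_mx (id : borel_matrix m n -> 'M[R]_(m, n)).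
Proof.
move=> i j _ B mB; rewrite setTI; apply: sub_sigma_algebra.
by exists i, j, B.
Qed.

Lemma random_mx_comp m n d (T : measurableType d) d' (T' : measurableType d')
    (X : T -> 'M[R]_(m, n)) (f : T' -> T) :
  measurable_fun setT f -> random_mx X -> random_mx (fun w => X (f w)).
Proof. by move=> mf mX i j; exact: measurableT_comp (mX i j) mf. Qed.

End Borel.

Section Independence.
Context {R : realType} {d : measure_display} {T : measurableType d}.
Variables (P : probability T R) (m p : nat) (X : nat -> T -> 'M[R]_(m, p)).
Hypothesis mX : forall k, random_mx (X k).
Hypothesis indepX : mutually_independent P X.

Definition cylinders k : set (set T) :=
  [set C | exists2 B : nat -> set 'M[R]_(m, p), (forall j, mx_borel (B j))
         & C = \bigcap_(j < k) (X j @^-1` B j)].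

(** A copy of the sample space that carries only the events determined by
    X_0, ..., X_(k-1), so that depending on the past is plain measurability. *)
Definition history k := g_sigma_algebraType (cylinders k).

Lemma borelT : mx_borel [set: 'M[R]_(m, p)].
Proof. exact: (@measurableT _ (@borel_matrix R m p)). Qed.

Lemma measurable_preimage k B : mx_borel B -> measurable (X k @^-1` B).
Proof.
by move=> mB; have := measurable_borel_matrix (mX k) measurableT mB; rewrite setTI.
Qed.

Lemma cylinders_setI k : setI_closed (cylinders k).
Proof.
move=> _ _ [B mB ->] [C mC ->]; exists (fun j => B j `&` C j).
  move=> j; apply: (@measurableI _ (@borel_matrix R m p)); first exact: mB.
  exact: mC.
by rewrite -bigcapI; apply: eq_bigcapr => j _; rewrite preimage_setI.
Qed.

Lemma cylinders_measurable k C : cylinders k C -> measurable C.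
Proof.
move=> [B mB ->]; by apply: bigcap_measurableType => j _; exact: measurable_preimage.
Qed.

Lemma history_measurable k C : <<s cylinders k>> C -> measurable C.
Proof.
apply: smallest_sub; last exact: cylinders_measurable.
exact: sigma_algebra_measurable.
Qed.

Lemma cylinders_S k C : cylinders k C -> cylinders k.+1 C.
Proof.
move=> [B mB ->]; exists (fun j => if (j < k)%N then B j else setT).
  by move=> j; case: ifP => _; [exact: mB|exact: borelT].
apply/seteqP; split=> w wB j /=.
  by move=> _; case: ifP => // jk; exact: wB.
move=> jk; have := wB j; rewrite /= jk; apply; exact: ltnW.
Qed.

Lemma random_mx_historyS k m' n (Y : T -> 'M[R]_(m', n)) :
  random_mx (Y : history k -> _) -> random_mx (Y : history k.+1 -> _).
Proof.
move=> mY i j _ B mB; have := mY i j measurableT B mB.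
apply: smallest_sub; first exact: smallest_sigma_algebra.
move=> C /cylinders_S; exact: sub_gen_smallest.
Qed.

Lemma random_mx_history k : random_mx (X k : history k.+1 -> _).
Proof.
move=> i j _ B mB; rewrite setTI; apply: sub_gen_smallest.
exists (fun l => if l == k then [set M : 'M[R]_(m, p) | B (M i j)] else setT).
  move=> l; case: ifP => _; last exact: borelT.
  by apply: sub_gen_smallest; exists i, j, B.
apply/seteqP; split=> w /= wB.
  by move=> l _; case: eqP => // ->.
by have := wB k (ltnSn k); rewrite eqxx.
Qed.

(** Independence of the k + 1 matrices X_0, ..., X_k splits off the factor of
    X_k; independence of the first k reassembles the others. *)
Lemma cylinders_independent k C B : cylinders k C -> mx_borel B ->
  P (C `&` X k @^-1` B) = (P C * P (X k @^-1` B))%E.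
Proof.
move=> [D mD ->] mB; pose J := [fset j in iota 0 k]%fset.
pose D' j := if j == k then B else D j.
have mD' j : mx_borel (D' j) by rewrite /D'; case: ifP.
have JE : [set` J] = `I_k.
  by apply/seteqP; split=> j /=; rewrite inE /= mem_iota.
have kJ : k \notin J by rewrite inE /= mem_iota ltnn andbF.
have D'E j : `I_k j -> D' j = D j by move=> jk; rewrite /D' ltn_eqF.
have D'k : D' k = B by rewrite /D' eqxx.
have eD : \bigcap_(j < k) (X j @^-1` D' j) = \bigcap_(j < k) (X j @^-1` D j).
  by apply: eq_bigcapr => j /D'E ->.
have eC : \bigcap_(j in [set` (k |` J)%fset]) (X j @^-1` D' j)
        = \bigcap_(j < k) (X j @^-1` D j) `&` X k @^-1` B.
  rewrite -eD -D'k; apply/seteqP; split=> w.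
    move=> wD; split; last by apply: (wD k); rewrite /= !inE eqxx.
    by move=> j jk; apply: wD; rewrite /= !inE /= mem_iota; apply/orP; right.
  by move=> [wD wk] j /=; rewrite !inE /= mem_iota => /orP[/eqP ->|/wD].
have := indepX (k |` J)%fset mD'; rewrite big_fsetU1 //=.
by rewrite -(indepX J mD') JE eD eC D'k muleC.
Qed.

(** Dynkin's pi-lambda theorem extends the independence from cylinders. *)
Lemma history_independent k C B : <<s cylinders k>> C -> mx_borel B ->
  P (C `&` X k @^-1` B) = (P C * P (X k @^-1` B))%E.
Proof.
move=> hC mB; set E := X k @^-1` B.
have mE : measurable E by exact: measurable_preimage.
have fE A : measurable A -> P A \is a fin_num by move=> mA; exact: fin_num_measure.
suff [] : [set A | measurable A /\ P (A `&` E) = (P A * P E)%E] C by [].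
move: C hC; rewrite -setI_closed_g_dynkin_g_sigma_algebra; last exact: cylinders_setI.
apply: smallest_sub; last first.
  move=> C hC; split; first exact: cylinders_measurable hC.
  exact: cylinders_independent.
split.
- by split=> //; rewrite setTI probability_setT mul1e.
- move=> A [mA AE]; split; first exact: measurableC.
  transitivity (P E - P (A `&` E))%E.
    by rewrite (setIC A E) -measureD ?ltey_eq ?fE // setDE setIC.
  rewrite AE probability_setC //.
  by rewrite muleBl ?mul1e ?fE.
- move=> F tF FE; have mF i : measurable (F i) by have [] := FE i.
  split; first exact: bigcupT_measurable.
  rewrite setI_bigcupl measure_bigcup; last 2 first.
  + by move=> i _; exact: measurableI.
  + exact: trivIset_setIr.
  rewrite measure_bigcup // muleC -(fineK (fE _ mE)) -nneseriesZl //.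
  apply: eq_eseriesr => i _; transitivity (P (F i `&` E)) => //.
  by rewrite (FE i).2 muleC fineK ?fE.
Qed.

End Independence.

(** * Convergence *)

Section SecondMoment.
Context {R : realType} {d : measure_display} {T : measurableType d}.
Variable P : probability T R.

(** Integrate the inequality 2 f <= f^2 / e + e with e slightly above c, which
    keeps e nonzero when c = 0. *)
Lemma expectation_le_second_moment (f : T -> R) c :
  measurable_fun setT f -> (forall w, 0 <= f w) -> 0 <= c ->
  (\int[P]_w (f w ^+ 2)%:E <= (c ^+ 2)%:E)%E -> ('E_P[f] <= c%:E)%E.
Proof.
move=> mf f0 c0 fc; apply/lee_addgt0Pr => e e0.
have ce0 : 0 < c + e by exact: ltr_wpDl.
pose a := (2 * (c + e))^-1; pose b := (c + e) / 2.
have a0 : 0 <= a by rewrite invr_ge0 mulr_ge0 // ltW.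
have b0 : 0 <= b by rewrite mulr_ge0 ?invr_ge0 // ltW.
have mf2 : measurable_fun setT (fun w => (f w ^+ 2)%:E).
  by apply/measurable_EFinP; exact: measurable_funX.
rewrite unlock; apply: (@le_trans _ _ (\int[P]_w (a%:E * (f w ^+ 2)%:E + b%:E))%E).
  apply: ge0_le_integral => //.
  - by move=> w _; rewrite lee_fin.
  - exact/measurable_EFinP.
  - by apply: emeasurable_funD => //; exact: measurable_funeM.
  move=> w _; rewrite -EFinM -EFinD lee_fin.
  have -> : a * f w ^+ 2 + b = f w + (f w - (c + e)) ^+ 2 * a.
    by rewrite /a /b; field; rewrite gt_eqF.
  by rewrite lerDl mulr_ge0 ?sqr_ge0.
rewrite ge0_integralD //; last first.
  - exact: measurable_funeM.
  - by move=> w _; rewrite -EFinM lee_fin mulr_ge0 ?sqr_ge0.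
rewrite ge0_integralZl //; last by move=> w _; rewrite lee_fin sqr_ge0.
have -> : (\int[P]__ b%:E = b%:E)%E.
  by have := expectation_cst P b; rewrite unlock.
apply: (@le_trans _ _ (a%:E * (c ^+ 2)%:E + b%:E)%E).
  by rewrite leeD2r // lee_wpmul2l.
rewrite -EFinM -!EFinD lee_fin.
have -> : c + e = a * c ^+ 2 + b + (2 * c + e) * e * a.
  by rewrite /a /b; field; rewrite gt_eqF.
by rewrite lerDl mulr_ge0 // mulr_ge0 ?addr_ge0 ?mulr_ge0 // ltW.
Qed.

End SecondMoment.

Section Iterates.
Context {R : realType} {d : measure_display} {T : measurableType d}.
Variables (P : probability T R) (n : nat) (H : T -> 'M[R]_n).

Lemma random_extrapolation d' (T' : measurableType d') (y z : T' -> 'cV[R]_n) :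
  random_mx y -> random_mx z ->
  random_mx (fun w => extrapolation P H (y w) (z w)).
Proof.
by move=> my mz; apply: random_mxD; apply: random_mxZ => //; exact: measurable_cst.
Qed.

Lemma random_next_y d' (T' : measurableType d') (h : T' -> 'M[R]_n)
    (y z : T' -> 'cV[R]_n) :
  random_mx h -> random_mx y -> random_mx z ->
  random_mx (fun w => next_y P H (h w) (y w) (z w)).
Proof.
move=> mh my mz; apply: random_mxD; first exact: random_extrapolation.
by apply/random_mxN/random_mxM => //; exact: random_extrapolation.
Qed.

Lemma random_next_z d' (T' : measurableType d') (h : T' -> 'M[R]_n)
    (y z : T' -> 'cV[R]_n) :
  random_mx h -> random_mx y -> random_mx z ->
  random_mx (fun w => next_z P H (h w) (y w) (z w)).
Proof.
move=> mh my mz; have mx := random_extrapolation my mz.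
apply: random_mxD.
  apply: random_mxD => //; apply: random_mxZ; first exact: measurable_cst.
  by apply: random_mxD => //; exact: random_mxN.
by apply/random_mxN/random_mxZ; [exact: measurable_cst|exact: random_mxM].
Qed.

Lemma measurable_potential d' (T' : measurableType d') (y z : T' -> 'cV[R]_n) :
  random_mx y -> random_mx z ->
  measurable_fun setT (fun w => potential P H (y w) (z w)).
Proof.
move=> my mz; apply: measurable_funD.
  by apply: measurable_bform => //; exact: random_mx_cst.
by apply: measurable_funM; [exact: measurable_cst|exact: measurable_sqnorm].
Qed.

End Iterates.

Lemma enorm2E (R : realType) n (v : 'cV[R]_n) : enorm2 v = Num.sqrt (sqnorm v).
Proof. by rewrite /enorm2 sqnormE. Qed.

Theorem theorem3p7 (R : realType) (d : measure_display) (T : measurableType d)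
    (P : probability T R) (m n p : nat)
    (A : 'M[R]_(m, n)) (b : 'cV[R]_m) (xs : 'cV[R]_n)
    (S : T -> 'M[R]_(m, p)) (Sk : nat -> T -> 'M[R]_(m, p))
    (x0 : 'cV[R]_n) (x y z : nat -> T -> 'cV[R]_n) :
  \rank A = n ->
  b = A *m xs ->
  random_mx S ->
  (forall k, random_mx (Sk k)) ->
  (forall k, same_law P (Sk k) S) ->
  mutually_independent P Sk ->
  let H := fun w => orth_proj (A^T *m S w) in
  let G := expect_mx P H in
  let mu := lambda_min G in
  let Gmhalf := invmx (psd_sqrt G) in
  let nu := lambda_max (expect_mx P (fun w => (Gmhalf *m H w *m Gmhalf) ^+ 2)) in
  let tau := Num.sqrt (mu / nu) in
  let r := fun k w => A *m x k w - b in
  0 < mu ->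
  (forall w, x 0%N w = x0 /\ y 0%N w = x0 /\ z 0%N w = x0) ->
  (forall k w, x k.+1 w = (1 + tau)^-1 *: y k w + (tau / (1 + tau)) *: z k w) ->
  (forall k w, y k.+1 w =
     x k.+1 w - mp_pinv ((Sk k w)^T *m A) *m (Sk k w)^T *m r k.+1 w) ->
  (forall k w, z k.+1 w =
     z k w + tau *: (x k.+1 w - z k w)
       - (tau / mu) *: (mp_pinv ((Sk k w)^T *m A) *m (Sk k w)^T *m r k.+1 w)) ->
  forall k : nat,
    ('E_P[fun w => enorm2 (y k w - xs)]
       <= (Num.sqrt 2 * (1 - tau) `^ (k%:R / 2) * enorm2 (x0 - xs))%:E)%E.
Proof.
move=> _ bE mS mSk law indep H G mu Gmhalf nu tau r mu_gt0 init xE yE zE k.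
have projH w : is_projector (H w).
  by split; [exact: orth_proj_sym|exact: orth_proj_idem].
have mATX d' (T' : measurableType d') (X : T' -> 'M[R]_(m, p)) :
    random_mx X -> random_mx (fun w => orth_proj (A^T *m X w)).
  by move=> mX; apply/random_orth_proj/random_mxM => //; exact: random_mx_cst.
have mH : random_mx H by exact: mATX.
have t0 : 0 < tau := tau_gt0 mH projH mu_gt0.
have t1 : tau <= 1 := tau_le1 mH projH mu_gt0.
pose Hk j w := orth_proj (A^T *m Sk j w).
(* all estimates concern the errors ey and ez of the iterates *)
pose ey j w := y j w - xs; pose ez j w := z j w - xs.
have ex j w : x j.+1 w - xs = extrapolation P H (ey j w) (ez j w).
  rewrite xE /extrapolation -/tau !scalerBr addrACA -opprD -scalerDl.
  have -> : (1 + tau)^-1 + tau / (1 + tau) = 1.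
    by field; rewrite gt_eqF // addr_gt0.
  by rewrite scale1r.
have sketch j w : mp_pinv ((Sk j w)^T *m A) *m (Sk j w)^T *m r j.+1 w
    = Hk j w *m extrapolation P H (ey j w) (ez j w).
  rewrite /r bE -mulmxBr ex mulmxA; congr (_ *m _).
  by rewrite -mulmxA mp_pinv_mul /Hk trmx_mul trmxK.
have eyS j w : ey j.+1 w = next_y P H (Hk j w) (ey j w) (ez j w).
  by rewrite /ey yE sketch /next_y -ex addrAC.
have ezS j w : ez j.+1 w = next_z P H (Hk j w) (ey j w) (ez j w).
  rewrite /ez zE sketch /next_z -ex -/tau -/mu.
  by rewrite addrAC; congr (_ - _); rewrite addrAC opprB addrA subrK.
have mhist j : random_mx (ey j : history Sk j -> _) /\
               random_mx (ez j : history Sk j -> _).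
  elim: j => [|j [my mz]].
    split=> i l; rewrite /ey /ez.
      by under eq_fun do rewrite (init _).2.1; exact: measurable_cst.
    by under eq_fun do rewrite (init _).2.2; exact: measurable_cst.
  have my' := random_mx_historyS my; have mz' := random_mx_historyS mz.
  have mHk : random_mx (Hk j : history Sk j.+1 -> _).
    by apply: mATX; exact: random_mx_history.
  split.
    rewrite (funext (eyS j)); exact: random_next_y mHk my' mz'.
  rewrite (funext (ezS j)); exact: random_next_z mHk my' mz'.
have midT j : measurable_fun setT (id : T -> history Sk j).
  by move=> _ C mC; rewrite setTI; exact: history_measurable mC.
have mTey j : random_mx (ey j) := random_mx_comp (midT j) (mhist j).1.
have mTez j : random_mx (ez j) := random_mx_comp (midT j) (mhist j).2.
have pot_ge0 u v : (0 <= (potential P H u v)%:E)%E.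
  by rewrite lee_fin potential_ge0.
have contraction j : (\int[P]_w (potential P H (ey j.+1 w) (ez j.+1 w))%:E
    <= (1 - tau)%:E * \int[P]_w (potential P H (ey j w) (ez j w))%:E)%E.
  have [my mz] := mhist j.
  pose f (u : history Sk j * borel_matrix m p) : \bar R :=
    (potential P H
      (next_y P H (orth_proj (A^T *m u.2)) (ey j u.1) (ez j u.1))
      (next_z P H (orth_proj (A^T *m u.2)) (ey j u.1) (ez j u.1)))%:E.
  pose g (u : history Sk j) : \bar R :=
    ((1 - tau) * potential P H (ey j u) (ez j u))%:E.
  rewrite -ge0_integralZl //; last 2 first.
  - apply/measurable_EFinP.
    exact: measurable_potential (mTey j) (mTez j).
  - by rewrite lee_fin subr_ge0.
  have -> : (\int[P]_w (potential P H (ey j.+1 w) (ez j.+1 w))%:E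
      = \int[P]_w f (w, Sk j w))%E.
    by apply: eq_integral => w _; rewrite eyS ezS.
  apply: (@integral_independent_le R d _ _ T (history Sk j) (borel_matrix m p)
    P id (Sk j) S f g) => //.
  - exact: measurable_borel_matrix.
  - exact: measurable_borel_matrix.
  - by move=> C D mC mD; exact: history_independent.
  - by move=> D mD; exact: law.
  - apply/measurable_EFinP.
    have mh : random_mx (fun u : history Sk j * borel_matrix m p =>
        orth_proj (A^T *m u.2)).
      apply: mATX; exact: (random_mx_comp
        (@measurable_snd _ _ (history Sk j) (borel_matrix m p))
        (@random_mx_id R m p)).
    have mfst := @measurable_fst _ _ (history Sk j) (@borel_matrix R m p).
    have my1 := random_mx_comp mfst my; have mz1 := random_mx_comp mfst mz.
    by apply: measurable_potential; [exact: random_next_y|exact: random_next_z].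
  - by move=> u; exact: pot_ge0.
  - apply/measurable_EFinP; apply: measurable_funM; first exact: measurable_cst.
    exact: measurable_potential.
  - move=> u; have [E le] := mean_potential_le mH projH mu_gt0 (ey j u) (ez j u).
    by have := E; rewrite unlock => ->; rewrite lee_fin.
pose D := sqnorm (x0 - xs).
have decay j : (\int[P]_w (potential P H (ey j w) (ez j w))%:E
    <= ((1 - tau) ^+ j * (2 * mu^-1 * D))%:E)%E.
  elim: j => [|j IH].
    have -> : (\int[P]_w (potential P H (ey 0%N w) (ez 0%N w))%:E
        = (potential P H (x0 - xs) (x0 - xs))%:E)%E.
      have := expectation_cst P (potential P H (x0 - xs) (x0 - xs)).
      rewrite unlock => <-; apply: eq_integral => w _.
      by rewrite /ey /ez (init w).2.1 (init w).2.2.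
    by rewrite lee_fin expr0 mul1r; exact: potential_diag_le.
  apply: (le_trans (contraction j)); rewrite exprS -mulrA EFinM.
  by rewrite lee_wpmul2l // lee_fin subr_ge0.
have D0 : 0 <= D := sqnorm_ge0 _.
(* mu times the potential dominates the squared error of y, and the initial
   potential is at most 2 / mu times the initial squared error: hence sqrt 2 *)
set c := Num.sqrt 2 * _ * _.
have c0 : 0 <= c by rewrite !mulr_ge0 ?sqrtr_ge0 ?powR_ge0.
have c2 : c ^+ 2 = 2 * (1 - tau) ^+ k * D.
  rewrite !exprMn sqr_sqrtr // enorm2E sqr_sqrtr // -powR_mulrn ?powR_ge0 //.
  by rewrite -powRrM divfK // powR_mulrn // subr_ge0.
apply: expectation_le_second_moment => //.
- under eq_fun do rewrite enorm2E.
  apply: (measurableT_comp _ (measurable_sqnorm (mTey k))).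
  by apply: continuous_measurable_fun; exact: sqrt_continuous.
- by move=> w; rewrite sqrtr_ge0.
apply: (@le_trans _ _
    (\int[P]_w (mu%:E * (potential P H (ey k w) (ez k w))%:E))%E).
  apply: ge0_le_integral => //.
  - by move=> w _; rewrite lee_fin sqr_ge0.
  - apply/measurable_EFinP; under eq_fun do rewrite enorm2E sqr_sqrtr ?sqnorm_ge0 //.
    exact: measurable_sqnorm (mTey k).
  - apply/measurable_EFinP; apply: measurable_funM; first exact: measurable_cst.
    exact: measurable_potential (mTey k) (mTez k).
  move=> w _; rewrite -EFinM lee_fin enorm2E sqr_sqrtr ?sqnorm_ge0 //.
  rewrite mulrDr mulVKf ?gt_eqF // lerDr mulr_ge0 ?(qform_inv_ge0 projH) //.
  exact: ltW.
rewrite ge0_integralZl //; last 2 first.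
- apply/measurable_EFinP; exact: measurable_potential (mTey k) (mTez k).
- by rewrite lee_fin ltW.
apply: (@le_trans _ _ (mu%:E * ((1 - tau) ^+ k * (2 * mu^-1 * D))%:E)%E).
  by apply: lee_wpmul2l; [rewrite lee_fin ltW|exact: decay].
by rewrite -EFinM lee_fin c2 le_eqVlt; apply/orP; left; apply/eqP; field; rewrite gt_eqF.
Qed.
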